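(* Let $\mathcal{P}$ be a set of prime numbers with the property that $$\frac{(\log x)^{4/3}}{x}\,\#\{p\in\mathcal{P}: p\le x\}$$ tends to infinity as $x\to\infty$. Let $p_1<p_2<p_3<\cdots$ be the enumeration of the set $\mathcal{P}$ in increasing order. Then the sequence $$p_{n+1}^2-p_np_{n+2}\qquad(n\ge 1)$$ changes sign infinitely often.
   Context: A real sequence changes sign infinitely often if it takes positive values for infinitely many $n$ and negative values for infinitely many $n$. The density hypothesis forces $\mathcal{P}$ to be infinite. *)

(* Defs.v *)
From HB Require Import structures.
From mathcomp Require Import all_boot all_order all_algebra finmap.
From mathcomp Require Import all_classical all_reals all_analysis.

Set Implicit Arguments.
Unset Strict Implicit.
Unset Printing Implicit Defensive.

Import Order.TTheory GRing.Theory Num.Theory.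
Import numFieldNormedType.Exports.

Local Open Scope classical_set_scope.
Local Open Scope ring_scope.

(* [fset_set] is the junk value [fset0] on infinite sets, but the set counted
   here is always finite. *)
Definition counting_fun (R : realType) (P : set nat) (x : R) : nat :=
  #|` fset_set [set p : nat | P p /\ p%:R <= x] |%fset.

(* 0-based: the p_1 < p_2 < ... of the usual enumeration is p 0 < p 1 < ... *)
Definition increasing_enumeration (P : set nat) (p : nat -> nat) : Prop :=
  {homo p : m n / (m < n)%N} /\ range p = P.

Definition changes_sign_infinitely_often (R : realType) (u : nat -> R) : Prop :=
  infinite_set [set n : nat | 0 < u n] /\ infinite_set [set n : nat | u n < 0].

(* Main.v *)
Require Import Defs.
From HB Require Import structures.
From mathcomp Require Import all_boot all_order all_algebra finmap.
From mathcomp Require Import all_classical all_reals all_analysis.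
From mathcomp Require Import zify lra.

Set Implicit Arguments.
Unset Strict Implicit.
Unset Printing Implicit Defensive.

Import Order.TTheory GRing.Theory Num.Theory.
Import numFieldNormedType.Exports.

Local Open Scope classical_set_scope.
Local Open Scope ring_scope.

(** Up to sign, the term at [n] compares the consecutive ratios
    [p n.+1 / p n] and [p n.+2 / p n.+1]; so if one of the two signs
    occurs only finitely often, the sequence [p] is eventually log-convex or
    eventually log-concave. The density of [P] enters only through the
    existence of arbitrarily late gaps smaller than the square root of [p n]
    ([small_gaps]): if all gaps from some point on were at least that large,
    [p] would grow quadratically, and [P] would have only O(sqrt x) elements
    up to [x].

    - If [p] is eventually log-convex, the ratios are bounded below by some
      constant larger than 1, so gaps are at least proportional to [p n] and
      eventually exceed its square root ([logconvex_large_gaps]).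

    - If [p] is eventually log-concave with a gap [d] at [a = p n], the next
      gap is at most [d + d ^ 2 / a]. Gaps are integers, so as soon as
      [d ^ 2 < a] the next gap is at most [d], and the inequality
      [d ^ 2 < a] persists. From then on the gaps are nonincreasing positive
      integers, hence eventually constant, and [p] is eventually an arithmetic
      progression ([logconcave_eventually_arith]). But no infinite arithmetic
      progression consists of primes. *)

Local Notation gap p n := (p n.+1 - p n)%N.

Lemma infinite_set_unbounded (A : set nat) :
  (forall N, exists2 n, (N <= n)%N & A n) -> infinite_set A.
Proof.
move=> unbA finA.
have [n] := unbA (\max_(i <- fset_set A) i).+1.
rewrite ltnNge => /negP nlt An; apply: nlt.
by apply: (@leq_bigmax_seq _ _ xpredT id n) => //; rewrite in_fset_set ?inE.
Qed.

(** Each step adds at least [sqrt (p n)], as for the solution [t ^ 2 / 4] of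
    [y' = sqrt y]; the constant is relaxed from 4 to 9 to leave room for the
    discrete step. *)
Lemma quadratic_growth (p : nat -> nat) (N : nat) :
  (forall n, p n < p n.+1)%N ->
  (forall n, N <= n -> p n <= gap p n ^ 2)%N ->
  forall k, (k ^ 2 <= 9 * p (N + k))%N.
Proof.
move=> p_lt large; elim=> [//|k IHk].
have := p_lt (N + k)%N; have := large _ (leq_addr k N).
rewrite addnS; set d := (p _ - p _)%N => d_sq dlt.
have -> : p (N + k).+1 = (p (N + k) + d)%N by rewrite /d; lia.
have d_gt0 : (0 < d)%N by rewrite /d; lia.
have k3d : (k <= 3 * d)%N by rewrite -leq_sqr expnMn; lia.
(* [2 * k + 1 <= 9 * d], which is where 9, instead of 4, is convenient. *)
rewrite -addn1 sqrnD; lia.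
Qed.

Lemma card_fset_set_image_II (f : nat -> nat) (A : set nat) (n : nat) :
  A `<=` f @` `I_n -> (#|` fset_set A|%fset <= n)%N.
Proof.
move=> AfI; have finI := finite_II n; have finfI := finite_image f finI.
have finA := sub_finite_set AfI finfI.
have := AfI; rewrite fset_set_sub// => /fsubset_leq_card/leq_trans; apply.
rewrite fset_set_image// (leq_trans (leq_imfset_card _ _ _))//=.
by rewrite fset_set_II (leq_trans (leq_imfset_card _ _ _))//= -cardE card_ord.
Qed.

(** Sampling at fourth powers turns [ln x <= 4 * m] into a bound of order
    [sqrt x] on the logarithmic factor, which the exponent 4/3, being at most
    2, does not exceed. *)
Lemma powR_ln_X4_le (R : realType) (m : nat) : (0 < m)%N ->
  ln (m%:R ^+ 4 : R) `^ (4%:R / 3%:R) <= 16%:R * m%:R ^+ 2.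
Proof.
move=> m0; have m1 : 1 <= m%:R :> R by rewrite ler1n.
have ln4 : ln (m%:R ^+ 4 : R) <= 4%:R * m%:R.
  have : ln m%:R <= m%:R - 1 :> R.
    by rewrite -[X in ln X](subrK 1) addrC le_ln1Dx//; lra.
  by rewrite lnXn ?(lt_le_trans ltr01)// -[ln _ *+ _]mulr_natl; lra.
have ln0 : 0 <= ln (m%:R ^+ 4 : R) by rewrite ln_ge0// exprn_ege1.
apply: (le_trans (ge0_ler_powR _ _ _ ln4)).
- by lra.
- by rewrite nnegrE.
- by rewrite nnegrE; lra.
apply: (@le_trans _ _ ((4%:R * m%:R) `^ 2%:R)).
  by apply: ler_powR; lra.
by rewrite powR_mulrn ?exprMn; lra.
Qed.

(** If all late gaps were at least the square root, then
    [quadratic_growth] would bound the number of terms up to [m ^ 4] by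
    [3 * m ^ 2] plus a constant, and [powR_ln_X4_le] would bound the quantity
    that tends to infinity at [x = m ^ 4]. *)
Lemma small_gaps (R : realType) (P : set nat) (p : nat -> nat) :
  (ln x `^ (4%:R / 3%:R) / x * (counting_fun P x)%:R)
     @[x --> (+oo : set_system R)] --> (+oo : set_system R) ->
  increasing_enumeration P p ->
  forall N, exists2 n, (N <= n)%N & (gap p n ^ 2 < p n)%N.
Proof.
move=> P_dense [p_lt p_range] N; apply: contrapT => no_small.
have large n : (N <= n -> p n <= gap p n ^ 2)%N.
  by move=> Nn; rewrite leqNgt; apply/negP => ?; apply: no_small; exists n.
have growth := quadratic_growth (fun n => p_lt _ _ (ltnSn n)) large.
have [M [_ big]] := cvgry_ge P_dense (16%:R * (N + 4)%:R + 1).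
pose m := (Num.truncn `|M|).+1.
have m1 : 1 <= m%:R :> R by rewrite ler1n.
have Mm : M < m%:R ^+ 4.
  apply: (le_lt_trans (ler_norm M)).
  apply: (lt_le_trans (truncnS_gt _)).
  by rewrite -[leLHS]expr1 ler_weXn2l.
have count : (counting_fun P (m%:R ^+ 4 : R) <= N + (3 * m ^ 2).+1)%N.
  apply: (@card_fset_set_image_II p) => q /= [].
  rewrite -p_range => -[n _ <-]; rewrite -natrX ler_nat => pn.
  exists n => //=; have [nN|Nn] := ltnP n N; first by lia.
  have := growth (n - N)%N; rewrite subnKC// => gn.
  suff : (n - N <= 3 * m ^ 2)%N by lia.
  by rewrite -leq_sqr expnMn -expnM; lia.
(* The quotient is at most [16 * m ^ 2 * (N + 3 * m ^ 2 + 1) / m ^ 4], hence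
   at most [16 * (N + 4)]. *)
have := big _ Mm; apply/negP; rewrite -ltNge.
have X4 : 0 < m%:R ^+ 4 :> R by rewrite exprn_gt0 ?(lt_le_trans ltr01).
rewrite mulrAC ltr_pdivrMr//.
apply: (@le_lt_trans _ _ (16%:R * m%:R ^+ 2 * (N + (3 * m ^ 2).+1)%:R)).
  by apply: ler_pM => //; rewrite ?powR_ge0 ?powR_ln_X4_le// ler_nat.
apply: (@le_lt_trans _ _ (16%:R * (N + 4)%:R * m%:R ^+ 4)); last first.
  by rewrite ltr_pM2r// ltrDl.
rewrite -!natrX -!natrM ler_nat.
have : (0 < m ^ 2)%N by rewrite expn_gt0.
have -> : (m ^ 4 = m ^ 2 * m ^ 2)%N by rewrite -expnD.
by nia.
Qed.

(** Since ratios of consecutive terms are nondecreasing, the relative gap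
    never drops below its value at [N], which is at least [1 / p N] because
    the gap there is a positive integer. A gap of at least [p n / p N] is no less than
    [sqrt (p n)] once [p n] is at least [p N ^ 2]. *)
Lemma logconvex_large_gaps (p : nat -> nat) (N : nat) :
  (forall n, p n < p n.+1)%N -> (0 < p N)%N ->
  (forall n, N <= n -> p n.+1 ^ 2 <= p n * p n.+2)%N ->
  exists M, (forall n, M <= n -> p n <= gap p n ^ 2)%N.
Proof.
move=> p_lt pN0 convex.
have p_ge n : (n <= p n)%N by elim: n => // n /leq_ltn_trans; apply.
have p_gt0 k : (0 < p (N + k))%N.
  by elim: k => [|k]; rewrite ?addn0 ?addnS// => /ltn_trans; apply.
have ratio k : (p (N + k) <= gap p (N + k) * p N)%N.
  elim: k => [|k]; rewrite ?addn0 ?addnS.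
    by have := p_lt N; nia.
  have := convex _ (leq_addr k N); have a0 := p_gt0 k; move: a0.
  have := p_lt (N + k)%N; have := p_lt (N + k).+1.
  set a := p (N + k)%N; set b := p _.+1; set c := p _.+2 => bc ab a0 cvx IH.
  have step : ((b - a) * b <= (c - b) * a)%N.
    by rewrite !mulnBl; move: cvx; rewrite expnS expn1 [(c * a)%N]mulnC; lia.
  rewrite -(leq_pmul2r a0).
  apply: (@leq_trans ((b - a) * p N * b)); first by rewrite mulnC leq_mul2r IH orbT.
  by rewrite mulnAC [leqRHS]mulnAC leq_mul2r step orbT.
exists (N + p N ^ 2)%N => n Mn.
have Nn : (N <= n)%N by lia.
have := p_gt0 (n - N)%N; have := ratio (n - N)%N; rewrite subnKC// => rn pn0.
rewrite -(leq_pmul2r pn0).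
apply: (@leq_trans (gap p n ^ 2 * p N ^ 2)).
  by rewrite -expnMn mulnn leq_sqr.
by rewrite leq_mul2l; apply/orP; right; have := p_ge n; lia.
Qed.

(** Log-concavity reads [a * e <= a * d + d ^ 2], that is,
    [e <= d + d ^ 2 / a]; the last fraction is smaller than 1 and [e], [d]
    are integers. *)
Lemma logconcave_gap_step (a d e : nat) :
  (a * (a + d + e) <= (a + d) ^ 2 -> d ^ 2 < a -> e <= d)%N.
Proof. by move=> cave small; rewrite leqNgt; apply/negP => de; nia. Qed.

(** By [logconcave_gap_step] a single gap below the square root forces all
    later ones to be no larger, while the terms grow; the gaps are then a
    nonincreasing sequence of positive integers, which stabilises. *)
Lemma logconcave_eventually_arith (p : nat -> nat) (N : nat) :
  (forall n, p n < p n.+1)%N ->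
  (forall n, N <= n -> p n * p n.+2 <= p n.+1 ^ 2)%N ->
  (gap p N ^ 2 < p N)%N ->
  exists m d, (0 < d)%N /\ forall k, p (m + k)%N = (p m + k * d)%N.
Proof.
move=> p_lt concave small.
have step n : (N <= n -> gap p n ^ 2 < p n -> gap p n.+1 <= gap p n)%N.
  move=> Nn; apply: logconcave_gap_step.
  rewrite subnKC; last exact: ltnW.
  by rewrite subnKC; [exact: concave | exact: ltnW].
have small_all k : (gap p (N + k) ^ 2 < p (N + k))%N.
  elim: k => [|k IHk]; rewrite ?addn0 ?addnS//.
  apply: leq_ltn_trans (ltn_trans IHk (p_lt _)).
  by rewrite leq_sqr step ?leq_addr.
have noninc n : (N <= n -> gap p n.+1 <= gap p n)%N.
  by move=> Nn; apply: step => //; rewrite -(subnKC Nn).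
have ex_gap : exists d, `[< exists2 n, (N <= n)%N & gap p n = d >].
  by exists (gap p N); apply/asboolP; exists N.
(* A nonincreasing sequence of integers is constant once it reaches its
   minimum. *)
have [d /asboolP[m Nm gap_m] min_d] := ex_minnP ex_gap.
exists m, d; split=> [|k]; first by rewrite -gap_m subn_gt0 p_lt.
have gap_const i : gap p (m + i) = d.
  apply/eqP; rewrite eqn_leq; apply/andP; split.
    elim: i => [|i IHi]; rewrite ?addn0 ?addnS ?gap_m//.
    by apply: leq_trans (noninc _ _) IHi; lia.
  by apply: min_d; apply/asboolP; exists (m + i)%N => //; lia.
elim: k => [|k IHk]; first by rewrite mul0n !addn0.
by rewrite addnS -(subnKC (ltnW (p_lt (m + k)%N))) gap_const IHk; lia.
Qed.

(** The term of index [a] is [a * (1 + d)]. *)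
Lemma no_prime_progression (a d : nat) :
  (0 < d)%N -> ~ (forall k, prime (a + k * d)).
Proof.
move=> d0 pr; have := pr 0%N; rewrite addn0 => /prime_gt1 a1.
have /primeP[_ /(_ a)] := pr a.
rewrite dvdn_addr// dvdn_mulr// => /(_ isT) /orP[] /eqP; nia.
Qed.

Theorem theorem1 (R : realType) (P : set nat) (p : nat -> nat)
    (P_prime : forall q : nat, P q -> prime q)
    (P_dense : (ln x `^ (4%:R / 3%:R) / x * (counting_fun P x)%:R)
                 @[x --> (+oo : set_system R)] --> (+oo : set_system R))
    (p_enum : increasing_enumeration P p) :
  changes_sign_infinitely_often
    (fun n : nat => (p n.+1)%:R ^+ 2 - (p n)%:R * (p n.+2)%:R : R).
Proof.
have small := small_gaps P_dense p_enum.
have [p_homo p_range] := p_enum.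
have p_lt n : (p n < p n.+1)%N by apply: p_homo.
have p_prime n : prime (p n) by apply: P_prime; rewrite -p_range; exists n.
split; apply: infinite_set_unbounded => N; apply: contrapT => none.
- have convex n : (N <= n -> p n.+1 ^ 2 <= p n * p n.+2)%N.
    move=> Nn; rewrite leqNgt; apply/negP => lt; apply: none; exists n => //=.
    by rewrite -natrX -natrM subr_gt0 ltr_nat.
  have [M large] := logconvex_large_gaps p_lt (prime_gt0 (p_prime N)) convex.
  by have [n /large] := small M; rewrite leqNgt => /negP.
- have concave n : (N <= n -> p n * p n.+2 <= p n.+1 ^ 2)%N.
    move=> Nn; rewrite leqNgt; apply/negP => lt; apply: none; exists n => //=.
    by rewrite -natrX -natrM subr_lt0 ltr_nat.
  have [n Nn small_n] := small N.
  have [|m [d [d0 arith]]] := logconcave_eventually_arith p_lt _ small_n.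
    by move=> i /(leq_trans Nn); apply: concave.
  by apply: (no_prime_progression d0 (a := p m)) => k; rewrite -arith.
Qed.
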